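(* Let $G$ be a $2$-pseudocompact $T_1$ strongly paratopological gyrogroup. Then $G$ is a strongly topological gyrogroup if and only if $wHs(G)\leq\omega$.
   Context: A gyrogroup is a nonempty set $G$ with a binary operation $\oplus$ such that: (G1) there is $0\in G$ with $0\oplus x=x=x\oplus 0$ for all $x\in G$; (G2) each $x\in G$ has an inverse $\ominus x\in G$ with $\ominus x\oplus x=0=x\oplus(\ominus x)$; (G3) for all $x,y\in G$ there is an automorphism $\mathrm{gyr}[x,y]$ of $(G,\oplus)$ with $x\oplus(y\oplus z)=(x\oplus y)\oplus \mathrm{gyr}[x,y](z)$ for all $z\in G$; (G4) $\mathrm{gyr}[x\oplus y,y]=\mathrm{gyr}[x,y]$ for all $x,y\in G$. A paratopological gyrogroup is a gyrogroup with a topology for which $\oplus:G\times G\to G$ is (jointly) continuous; it is a topological gyrogroup if moreover $x\mapsto\ominus x$ is continuous. A paratopological (resp. topological) gyrogroup is called a strongly paratopological (resp. strongly topological) gyrogroup if there is a neighborhood base $\mathcal U$ at $0$ such that $\mathrm{gyr}[x,y](U)=U$ for all $U\in\mathcal U$ and $x,y\in G$. For $V\subseteq G$, $\ominus V=\{\ominus v:v\in V\}$. $G$ is $2$-pseudocompact if $\bigcap_{n\in\omega}\overline{\ominus U_n}\neq\emptyset$ for every decreasing sequence $\{U_n:n\in\omega\}$ of nonempty open subsets of $G$ (decreasing: $U_n\supseteq U_{n+1}$ for all $n$). The weakly Hausdorff number $wHs(G)$ of a $T_1$ paratopological gyrogroup $G$ is the minimum cardinal $\kappa$ such that for every neighborhood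 $U$ of $0$ there is a family $\gamma$ of neighborhoods of $0$ with $|\gamma|\le\kappa$ and $\bigcap_{V\in\gamma}(\ominus V)\subseteq U$. *)

(* Defs.v *)
From HB Require Import structures.
From mathcomp Require Import all_boot.
From mathcomp Require Import boolp classical_sets functions cardinality.
From mathcomp Require Import topology.

Set Implicit Arguments.
Unset Strict Implicit.
Unset Printing Implicit Defensive.

Local Open Scope classical_set_scope.
Local Open Scope card_scope.

Declare Scope gyro_scope.
Delimit Scope gyro_scope with gyro.
Local Open Scope gyro_scope.

(* gyr_bij and gyrD together say that gyr x y is an automorphism of the
   magma (G, gadd); no topological condition is put on it. *)
HB.mixin Record isGyrogroup (G : Type) := {
  gzero : G;
  gadd : G -> G -> G;
  gopp : G -> G;
  gyr : G -> G -> G -> G;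
  gadd0x : forall x, gadd gzero x = x;
  gaddx0 : forall x, gadd x gzero = x;
  gaddNx : forall x, gadd (gopp x) x = gzero;
  gaddxN : forall x, gadd x (gopp x) = gzero;
  gyr_bij : forall x y, bijective (gyr x y);
  gyrD : forall x y a b, gyr x y (gadd a b) = gadd (gyr x y a) (gyr x y b);
  gyro_assoc : forall x y z,
    gadd x (gadd y z) = gadd (gadd x y) (gyr x y z);
  gyr_loop : forall x y z, gyr (gadd x y) y z = gyr x y z
}.

#[short(type="gyrogroupType")]
HB.structure Definition Gyrogroup := {G of isGyrogroup G}.

Notation "x ⊕ y" := (gadd x y) (at level 50, left associativity) : gyro_scope.
Notation "⊖ x" := (gopp x) (at level 35, right associativity) : gyro_scope.

#[short(type="topologicalPreGyrogroupType")]
HB.structure Definition TopologicalPreGyrogroup :=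
  {G of isGyrogroup G & Topological G}.

HB.mixin Record isParatopologicalGyrogroup G & TopologicalPreGyrogroup G := {
  gadd_continuous : continuous (fun p : G * G => p.1 ⊕ p.2)
}.

#[short(type="paratopologicalGyrogroupType")]
HB.structure Definition ParatopologicalGyrogroup :=
  {G of TopologicalPreGyrogroup G & isParatopologicalGyrogroup G}.

Section ParatopologicalGyrogroupNotions.
Variable G : paratopologicalGyrogroupType.

Definition topological_gyrogroup : Prop := continuous (fun x : G => ⊖ x).

Definition nbhs_base_at (x : G) (B : set (set G)) : Prop :=
  B `<=` nbhs x /\ forall N, nbhs x N -> exists2 U, B U & U `<=` N.

Definition gyr_invariant_base : Prop :=
  exists B : set (set G), nbhs_base_at gzero B /\
    forall U, B U -> forall x y : G, gyr x y @` U = U.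

Definition strongly_paratopological_gyrogroup : Prop := gyr_invariant_base.

Definition strongly_topological_gyrogroup : Prop :=
  topological_gyrogroup /\ gyr_invariant_base.

Definition gopp_set (V : set G) : set G := [set ⊖ v | v in V].

Definition two_pseudocompact : Prop :=
  forall U : nat -> set G,
    (forall n, open (U n)) -> (forall n, U n !=set0) ->
    (forall n, U n.+1 `<=` U n) ->
    \bigcap_n closure (gopp_set (U n)) !=set0.

(* Cardinals are represented by sets over arbitrary types, compared by #<=. *)
Definition wHs_bound (T : Type) (k : set T) : Prop :=
  forall U : set G, nbhs gzero U ->
    exists gamma : set (set G),
      [/\ gamma `<=` nbhs gzero, gamma #<= k &
          \bigcap_(V in gamma) gopp_set V `<=` U].

(* The cardinality of k is wHs(G), the least cardinal satisfying wHs_bound. *)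
Definition is_wHs (T : Type) (k : set T) : Prop :=
  wHs_bound k /\
  forall (T' : Type) (k' : set T'), wHs_bound k' -> k #<= k'.

Definition wHs_le (T : Type) (k : set T) : Prop :=
  exists (T' : Type) (k' : set T'), is_wHs k' /\ k' #<= k.

End ParatopologicalGyrogroupNotions.

(* Main.v *)
(** For the direct implication, [wHs(G)] is at most [1], as [⊖U] is itself a
    neighbourhood of [0] for every neighbourhood [U].

    Conversely, write [cl] for closure.  Invariance of small neighbourhoods
    under gyrations gives [cl(⊖B) ⊆ ⊖N] for every neighbourhood [N] and some
    [B] depending on it.  Fix [U], take [V ⊕ V ⊆ U] and countably many [V_n]
    with [⋂ ⊖V_n ⊆ V], then [W_n] decreasing with [cl(⊖W_{n+1}) ⊆ ⊖(W_n ∩ V_n)].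
    If no [W_n] were contained in [cl(⊖U)], 2-pseudocompactness applied to the
    sets [int W_n \ cl(⊖U)] would give a point [x] of [⋂ ⊖V_n ⊆ V] whose
    neighbourhood [x ⊕ V ⊆ U] meets [⊖(int W_n \ cl(⊖U))], which is absurd.
    So [cl(⊖U)] is a neighbourhood of [0], and [⊖] is continuous at [0].
    An explicit formula for [⊖(x ⊕ z)] in terms of [x], [z], [⊖x] and [⊖z]
    carries continuity from [0] to every point [x]. *)
Require Import Defs.
From mathcomp Require Import all_boot.
From mathcomp Require Import boolp functions cardinality.
From mathcomp Require Import classical_sets topology.

Set Implicit Arguments.
Unset Strict Implicit.
Unset Printing Implicit Defensive.

Local Open Scope classical_set_scope.
Local Open Scope card_scope.
Local Open Scope gyro_scope.

Lemma card_set1_le T U (x : T) (B : set U) : B !=set0 -> [set x] #<= B.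
Proof.
move=> [y By]; have /card_eqPle[xy _] := eq_card1 x y.
by apply: card_le_trans xy _; apply: subset_card_le => _ ->.
Qed.

Lemma set0_card_le T U (B : set U) : @set0 T #<= B.
Proof.
by apply: card_le_trans (subset_card_le (@sub0set U B)); rewrite card_le0.
Qed.

Section GyrogroupAlgebra.
Variable G : gyrogroupType.
Implicit Types a b c x z : G.

Lemma gyr_inj a b : injective (gyr a b).
Proof. exact: bij_inj (gyr_bij a b). Qed.

Lemma gadd_injl a : injective (gadd a).
Proof.
move=> b c /(congr1 (gadd (⊖ a))); rewrite !gyro_assoc gaddNx !gadd0x.
exact: gyr_inj.
Qed.

Lemma gyr0x a b : gyr gzero a b = b.
Proof. by apply: (@gadd_injl a); rewrite -{1}[a]gadd0x -gyro_assoc gadd0x. Qed.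

(** The loop axiom turns [gyr (⊖ a) a] into [gyr gzero a], which is the identity. *)
Lemma gaddKx a b : ⊖ a ⊕ (a ⊕ b) = b.
Proof. by rewrite gyro_assoc gaddNx gadd0x -gyr_loop gaddNx gyr0x. Qed.

Lemma goppK a : ⊖ ⊖ a = a.
Proof. by apply: (@gadd_injl (⊖ a)); rewrite gaddxN gaddNx. Qed.

Lemma gaddNKx a b : a ⊕ (⊖ a ⊕ b) = b.
Proof. by rewrite -{1}[a]goppK gaddKx. Qed.

Lemma gopp_unique a b : a ⊕ b = gzero -> ⊖ a = b.
Proof. by move=> ab0; apply: (@gadd_injl a); rewrite gaddxN. Qed.

Lemma gopp0 : ⊖ gzero = gzero :> G.
Proof. by apply: gopp_unique; rewrite gadd0x. Qed.

Lemma gyrx0 a b : gyr a b gzero = gzero.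
Proof.
by apply: (@gadd_injl (gyr a b gzero)); rewrite -gyrD !gaddx0.
Qed.

Lemma gyrN a b c : gyr a b (⊖ c) = ⊖ gyr a b c.
Proof. by apply/esym/gopp_unique; rewrite -gyrD gaddxN gyrx0. Qed.

Lemma gaddK_gyr a b : (a ⊕ b) ⊕ gyr a b (⊖ b) = a.
Proof. by rewrite -gyro_assoc gaddxN gaddx0. Qed.

Lemma goppD a b : ⊖ (a ⊕ b) = gyr a b (⊖ b ⊕ ⊖ a).
Proof. by apply: gopp_unique; rewrite -gyro_assoc gaddNKx gaddxN. Qed.

Lemma gyrNNK a b : cancel (gyr (⊖ b) (⊖ a)) (gyr a b).
Proof.
move=> c; rewrite -[c](gaddNKx (a ⊕ b)); set d := _ ⊕ c.
have: ⊖ (a ⊕ b) ⊕ gyr a b (gyr (⊖ b) (⊖ a) ((a ⊕ b) ⊕ d)) = d.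
  rewrite goppD -gyrD -gyro_assoc.
  by apply: (@gadd_injl (a ⊕ b)); rewrite -gyro_assoc !gaddNKx.
by move=> {2}<-; rewrite gaddNKx.
Qed.

(** Gyrations are avoided because the dependence of [gyr x z] on [z] is not known to be
    continuous. *)
Lemma goppD_nogyr x z :
  ⊖ (x ⊕ z) = x ⊕ (z ⊕ ((⊖ z ⊕ ⊖ x) ⊕ (⊖ z ⊕ ⊖ x))).
Proof.
rewrite goppD; set s := ⊖ z ⊕ ⊖ x.
(* With the second summand in this form, associativity read backwards absorbs the outer gyration,
   and [x] and [z] cancel. *)
have {3}-> : s = gyr (⊖ z) (⊖ x) (gyr x z s).
  by apply: (@gyr_inj x z); rewrite gyrNNK.
by rewrite /s -gyro_assoc !gaddNKx.
Qed.

End GyrogroupAlgebra.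

Section ParatopologicalGyrogroup.
Variable G : paratopologicalGyrogroupType.
Implicit Types (x : G) (A N U V W : set G).

Lemma cvg_gadd T (F : set_system T) {FF : Filter F} (f g : T -> G) (a b : G) :
  f @ F --> a -> g @ F --> b -> (fun t => f t ⊕ g t) @ F --> a ⊕ b.
Proof.
move=> fa gb.
exact: (@continuous2_cvg _ _ _ _ F FF f g gadd a b (@gadd_continuous G (a, b))).
Qed.

Lemma gopp_setE A x : gopp_set A x = A (⊖ x).
Proof.
apply/propext; split=> [[v Av <-]|Ax]; first by rewrite goppK.
by exists (⊖ x) => //; rewrite goppK.
Qed.

Lemma nbhs_gadd_set x W : nbhs gzero W -> nbhs x [set y | W (⊖ x ⊕ y)].
Proof.
move=> W0.
have /(_ W) : (fun y => ⊖ x ⊕ y) @ x --> ⊖ x ⊕ x.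
  by apply: cvg_gadd; [exact: cvg_cst|exact: cvg_id].
by rewrite gaddNx; exact.
Qed.

Lemma gadd_halve N : nbhs gzero N ->
  exists2 W, nbhs (gzero : G) W & forall a b, W a -> W b -> N (a ⊕ b).
Proof.
move=> N0; have := @gadd_continuous G (gzero, gzero) N.
rewrite /= gadd0x => /(_ N0) [[A B] /= [A0 B0] ABN].
exists (A `&` B); first exact: filterI.
by move=> a b [Aa _] [_ Bb]; exact: (ABN (a, b)).
Qed.

Lemma closure_gopp_sub N : gyr_invariant_base G -> nbhs gzero N ->
  exists2 B, nbhs (gzero : G) B &
    forall x, closure (gopp_set B) x -> N (⊖ x).
Proof.
move=> [S [[Snbhs Sbase] Sgyr]] N0.
have gyrS B a b c : S B -> B c -> B (gyr a b c).
  by move=> SB Bc; rewrite -(Sgyr B SB a b); exists c.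
have [N' SN' N'N] := Sbase N N0.
have [W W0 WN'] := @gadd_halve N' (Snbhs _ SN').
have [B SB BW] := Sbase W W0.
exists B; first exact: Snbhs.
move=> x /(_ _ (nbhs_gadd_set x (Snbhs _ SB))) [y []].
rewrite gopp_setE /=; set w := ⊖ x ⊕ y => BNy Bw; apply: N'N.
(* Hence [⊖ x] is a gyration of [gyr x w w ⊕ ⊖ y], whose two terms lie in [B]; the sum lies in the
   invariant set [N']. *)
have -> : x = y ⊕ ⊖ gyr x w w.
  by rewrite -gyrN -{1}(gaddK_gyr x w) gaddNKx.
rewrite goppD goppK; apply: (gyrS) => //.
by apply: WN'; apply: BW => //; exact: gyrS.
Qed.

Lemma gopp_continuous_at0 :
  (fun x => ⊖ x) @ (gzero : G) --> (gzero : G) -> topological_gyrogroup G.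
Proof.
move=> opp0 x.
have z0 : (fun y => ⊖ x ⊕ y) @ x --> gzero.
  by move=> W; exact: nbhs_gadd_set.
have Nz0 : (fun y => ⊖ (⊖ x ⊕ y)) @ x --> gzero.
  by move=> W /opp0; exact: z0.
have s0 : (fun y => ⊖ (⊖ x ⊕ y) ⊕ ⊖ x) @ x --> gzero ⊕ ⊖ x.
  by apply: cvg_gadd => //; exact: cvg_cst.
rewrite /continuous_at.
(* Apply [goppD_nogyr] to [y = x ⊕ z] with [z = ⊖ x ⊕ y]: as [z] and [⊖ z] tend to [gzero], the
   limit is [x ⊕ (⊖ x ⊕ ⊖ x) = ⊖ x]. *)
have -> : (fun y : G => ⊖ y) = (fun y => x ⊕ ((⊖ x ⊕ y) ⊕
    ((⊖ (⊖ x ⊕ y) ⊕ ⊖ x) ⊕ (⊖ (⊖ x ⊕ y) ⊕ ⊖ x)))).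
  by apply/funext => y; rewrite -goppD_nogyr gaddNKx.
have := cvg_gadd (cvg_cst x) (cvg_gadd z0 (cvg_gadd s0 s0)).
by rewrite !gadd0x gaddNKx; apply.
Qed.

Lemma wHs_bound_countable T (k : set T) : wHs_bound G k -> k #<= [set: nat] ->
  forall U, nbhs gzero U -> exists2 V : nat -> set G,
    forall n, nbhs gzero (V n) & \bigcap_n gopp_set (V n) `<=` U.
Proof.
move=> kG kN U U0; have [gamma [g0 gk gU]] := kG U U0.
have /countable_injP[f finj] : countable gamma := card_le_trans gk kN.
(* The [n]-th set is the member of [gamma] coded by [n], or all of [G] if there is none. *)
exists (fun n => [set v | forall A, gamma A -> f A = n -> A v]).
  move=> n; have [[A gA fA]|noA] := pselect (exists2 A, gamma A & f A = n).
    apply: filterS (g0 A gA) => v Av B gB fB.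
    by rewrite (finj B A) ?inE// fB fA.
  by apply: filterS filterT => v _ A gA fA; case: noA; exists A.
move=> x Vx; apply: gU => A gA; rewrite gopp_setE.
by have := Vx (f A) I; rewrite gopp_setE; apply.
Qed.

Lemma nbhs_closure_gopp T (k : set T) U :
  gyr_invariant_base G -> two_pseudocompact G ->
  wHs_bound G k -> k #<= [set: nat] ->
  nbhs gzero U -> nbhs gzero (closure (gopp_set U)).
Proof.
move=> strongG pcG kG kN U0.
have [Y Y0 YU] := @gadd_halve U U0.
have [V V0 VY] := @wHs_bound_countable _ _ kG kN _ Y0.
have /choice[h hP] : forall N, exists B, nbhs gzero N ->
    nbhs gzero B /\ forall x, closure (gopp_set B) x -> N (⊖ x).
  move=> N; have [N0|] := pselect (nbhs gzero N); last by exists N.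
  by have [B B0 BN] := @closure_gopp_sub N strongG N0; exists B.
pose W := fix W n := if n is m.+1 then h (W m `&` V m) else setT.
have W0 n : nbhs gzero (W n).
  elim: n => [|n IH] /=; first exact: filterT.
  exact: (hP _ (filterI IH (V0 n))).1.
have WV n x : closure (gopp_set (W n.+1)) x -> (W n `&` V n) (⊖ x).
  exact: (hP _ (filterI (W0 n) (V0 n))).2.
apply: contrapT => nU.
pose O n := (W n)° `&` ~` closure (gopp_set U).
have [|||x xO] := pcG O.
- move=> n; apply: openI; first exact: open_interior.
  exact/closed_openC/closed_closure.
(* If [O n] were empty, the interior of [W n] would lie in [closure (gopp_set U)], against [nU]. *)
- move=> n; apply: contrapT => /set0P/negP; rewrite negbK => /eqP On0.
  apply: nU; apply: filterS (nbhs_interior (W0 n)) => y Wy.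
  by apply: contrapT => Uy; have : set0 y by rewrite -On0.
- move=> n; apply: setSI; apply: interiorS => y Wy.
  rewrite -[y]goppK; apply: (WV n (⊖ y) _).1.
  by apply: subset_closure; rewrite gopp_setE goppK.
(* Membership of [x] in [gopp_set (V n)] comes from the closure at index [n.+1]. *)
have Yx : Y x.
  apply: VY => n _; rewrite gopp_setE; apply: (WV n x _).2.
  apply: closure_subset (xO n.+1 I) => y; rewrite !gopp_setE.
  by case=> /interior_subset.
(* Any index would do: [y = x ⊕ (⊖ x ⊕ y)] lies in [U], yet [⊖ y] avoids [closure (gopp_set U)]. *)
have [y []] := xO 0 I _ (nbhs_gadd_set x Y0).
rewrite gopp_setE => -[_ nUy] /= Yy; apply: nUy.
apply: subset_closure; rewrite gopp_setE goppK -(gaddNKx x y).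
exact: YU.
Qed.

Lemma wHs_bound1 : topological_gyrogroup G -> wHs_bound G [set tt].
Proof.
move=> oppG U U0; exists [set gopp_set U]; split.
- move=> _ ->; have -> : gopp_set U = [set x | U (⊖ x)].
    exact/funext/gopp_setE.
  by apply: (oppG gzero U); rewrite gopp0.
- by apply: card_set1_le; exists tt.
- by move=> x /(_ _ erefl); rewrite !gopp_setE goppK.
Qed.

(** [wHs_le] asks for an attained minimum; below the bound 1 it is 0 or 1, according to whether the
    empty cardinal is already a bound. *)
Lemma wHs_le_nat : wHs_bound G [set tt] -> wHs_le G [set: nat].
Proof.
move=> b1.
have [b0|nb0] := pselect (wHs_bound G (@set0 unit)).
  exists unit, set0; split; last exact: set0_card_le.
  by split=> // T k _; exact: set0_card_le.
exists unit, [set tt]; split; last by apply: card_set1_le; exists 0.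
split=> // T k kb; apply: card_set1_le; apply: contrapT => /set0P/negP.
rewrite negbK => /eqP k0; apply: nb0 => U /kb[gamma [g0 gk gU]].
exists gamma; split=> //; apply: card_le_trans gk _.
by rewrite k0; exact: set0_card_le.
Qed.

End ParatopologicalGyrogroup.

Theorem theorem4p13 (G : paratopologicalGyrogroupType)
    (strongG : strongly_paratopological_gyrogroup G)
    (T1G : accessible_space G)
    (pcG : two_pseudocompact G) :
  strongly_topological_gyrogroup G <-> wHs_le G [set: nat]%classic.
Proof.
split=> [[oppG _]|[T [k [[kG _] kN]]]]; first exact/wHs_le_nat/wHs_bound1.
split=> //; apply: gopp_continuous_at0 => N N0.
(* This choice of [U] makes [⊖] send [closure (gopp_set U)] into [N]. *)
have [U U0 UN] := @closure_gopp_sub G N strongG N0.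
exact: filterS UN (nbhs_closure_gopp strongG pcG kG kN U0).
Qed.
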